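(* Let $\mu>0$, let $A\in\mathbb{R}^{m\times n}$ or $\mathbb{C}^{m\times n}$ with $m\le n$, let $L\in\mathbb{R}^{n\times n}$, and let $\theta>0$. Define $$Q(\theta)=\theta(\mu A^TA+\theta I)^{-1}\Big((L^TL+\theta I)^{-1}(\theta I-\mu A^TA)-I\Big),$$ a matrix whose entries depend on the value of $\theta$. Then the optimal relaxation parameter $\alpha^*$ of over-relaxed ADMM, i.e. the value of $\alpha$ minimizing the spectral radius $\rho(I+\alpha Q(\theta))$ of its iteration matrix, can be directly calculated using the closed-form formula $$\alpha^*=-\frac{2}{\lambda_1(Q(\theta))+\lambda_n(Q(\theta))}.$$ Thus the optimal relaxation parameter $\alpha^*$ can be computed as long as a value of $\theta$ is given.
   Context: $A^T$ denotes the transpose (conjugate transpose if $A$ is complex), $I$ is the $n\times n$ identity matrix, $\rho$ is the spectral radius, and $\lambda_i(T)$ is the $i$th smallest eigenvalue of an $n\times n$ matrix $T$, so $\lambda_1(Q(\theta))$ and $\lambda_n(Q(\theta))$ are the smallest and largest eigenvalues of $Q(\theta)$. Over-relaxed ADMM with penalty parameter $\theta$ and relaxation parameter $\alpha$ for the problem $\min_u \frac{\mu}{2}\|Au-f\|^2+\frac12\|Lu\|^2$ is ADMM applied to $\frac{\mu}{2}\|Au-f\|^2+\frac12\|Lw\|^2+\frac\theta2\|w-u-b\|^2$ (minimize over $w$, then over $u$, then update the multiplier by $b^{k+1}=b^k+u^{k+1}-w^{k+1}$) in which $w^{k+1}$ is replaced by $\alpha w^{k+1}+(1-\alpha)u^k$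 in the $u$- and $b$-updates. Written as a fixed-point iteration in $u$ alone, its iteration matrix is $I+\alpha Q(\theta)$, and its convergence factor is $\zeta(\theta,\alpha)=\rho(I+\alpha Q(\theta))$.
   Formalization: The optimality of α* is stated for Q(θ) with all eigenvalues real (the formula fails for some Q(θ) with nonreal eigenvalues), and that α* is the only minimizer is stated for invertible Q(θ) (for singular Q(θ) minimizers are not unique). *)

(* Defs.v *)
From HB Require Import structures.
From mathcomp Require Import all_boot all_order all_algebra.
From mathcomp Require Import complex.

Set Implicit Arguments.
Unset Strict Implicit.
Unset Printing Implicit Defensive.

Import Order.TTheory GRing.Theory Num.Theory.
Import ComplexField.

Local Open Scope ring_scope.
Local Open Scope complex_scope.
Local Open Scope sesquilinear_scope.

Section Spectrum.
Variables (R : rcfType) (n : nat).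
Implicit Type T : 'M[R[i]]_n.

(* Eigenvalues are repeated according to algebraic multiplicity, in an
   unspecified order. *)
Definition spectrum T : seq R[i] :=
  sval (closed_field_poly_normal (char_poly T)).

Lemma char_poly_spectrum T :
  char_poly T = \prod_(z <- spectrum T) ('X - z%:P).
Proof.
rewrite /spectrum; case: closed_field_poly_normal => s /= Ds.
by rewrite {1}Ds (monicP (char_poly_monic T)) scale1r.
Qed.

Lemma mem_spectrum T z : (z \in spectrum T) = eigenvalue T z.
Proof.
by rewrite eigenvalue_root_char char_poly_spectrum root_prod_XsubC.
Qed.

Definition spectral_radius T : R :=
  \big[Num.max/0]_(z <- spectrum T) Normc.normc z.

(* The eigenvalues can be ordered. For Qmx below this is not automatic: with
   m = 1, n = 2, mu = theta = 1, A = (1 -1), L = diag(0, 2) the characteristic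
   polynomial of Q(theta) is 'X^2 + 14/15 'X + 4/15, without real root. *)
Definition real_spectrum T : Prop := {in spectrum T, forall z, z \is Num.real}.

(* The k-th smallest eigenvalue of T, counted from k = 1. Meaningful only when
   1 <= k <= n and real_spectrum T holds: it looks at real parts only. *)
Definition lambda (k : nat) T : R :=
  nth 0 (sort <=%R [seq complex.Re z | z <- spectrum T]) k.-1.

End Spectrum.

Section ADMM.
Variables (R : rcfType) (m n : nat).
Variables (mu : R) (A : 'M[R[i]]_(m, n)) (L : 'M[R]_n).

Definition realmx (p q : nat) (M : 'M[R]_(p, q)) : 'M[R[i]]_(p, q) :=
  map_mx (real_complex R) M.

Definition sqnorm (p : nat) (v : 'cV[R[i]]_p) : R :=
  \sum_i Normc.normc (v i 0) ^+ 2.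

Definition is_argmin (p : nat) (J : 'cV[R[i]]_p -> R) (x : 'cV[R[i]]_p) : Prop :=
  forall y, J x <= J y.

Definition aug_lagrangian (f : 'cV[R[i]]_m) (theta : R)
    (u w b : 'cV[R[i]]_n) : R :=
  mu / 2 * sqnorm (A *m u - f) + 1 / 2 * sqnorm (realmx L *m w)
  + theta / 2 * sqnorm (w - u - b).

Definition over_relax (alpha : R) (w u : 'cV[R[i]]_n) : 'cV[R[i]]_n :=
  alpha%:C *: w + (1 - alpha)%:C *: u.

(* The w-value produced by step k is stored as w k.+1; the relaxed vector that
   replaces it in the two later updates is only computed on the fly. *)
Definition admm_run (f : 'cV[R[i]]_m) (theta alpha : R)
    (u w b : nat -> 'cV[R[i]]_n) : Prop :=
  forall k,
    let wr := over_relax alpha (w k.+1) (u k) in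
    [/\ is_argmin (fun x => aug_lagrangian f theta (u k) x (b k)) (w k.+1),
        is_argmin (fun x => aug_lagrangian f theta x wr (b k)) (u k.+1)
      & b k.+1 = b k + u k.+1 - wr].

(* G is the iteration matrix of the method as an affine fixed-point iteration
   in u alone. The initial multiplier b 0 is arbitrary; only from the first
   completed step on is b a function of u, so the recursion starts at u 1. *)
Definition is_iteration_matrix (f : 'cV[R[i]]_m) (theta alpha : R)
    (G : 'M[R[i]]_n) : Prop :=
  exists c : 'cV[R[i]]_n, forall u w b, admm_run f theta alpha u w b ->
    forall k, u k.+2 = G *m u k.+1 + c.

Definition Qmx (theta : R) : 'M[R[i]]_n :=
  let P := mu%:C *: (A ^t* *m A) in
  let S := (realmx L)^T *m realmx L in
  let tI := theta%:C%:M in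
  theta%:C *: (invmx (P + tI) *m (invmx (S + tI) *m (tI - P) - 1%:M)).

Definition conv_factor (theta alpha : R) : R :=
  spectral_radius (1%:M + alpha%:C *: Qmx theta).

(* The relaxation parameter ranges over all real numbers. *)
Definition is_optimal_relaxation (theta alpha : R) : Prop :=
  forall beta, conv_factor theta alpha <= conv_factor theta beta.

End ADMM.

(* Main.v *)
(* Writing P = mu A^*A, S = L^T L, t = theta, the optimality conditions of the
   two minimizations give t b_k = mu A^* f - P u_k after the first step, which
   eliminates w and b and leaves u_{k+1} = (1 + alpha Q) u_k + c. Moreover
   Q = - t (P + t)^-1 (S + t)^-1 (P + S), and positive semidefiniteness of P and
   S forbids positive eigenvalues of Q. For a real spectrum with extremes
   a <= b <= 0, minimizing max |1 + alpha z| over the spectrum is then the scalar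
   minimax problem of balancing 1 + alpha a = -(1 + alpha b). *)
Require Import Defs.
From mathcomp Require Import all_boot all_order all_algebra.
From mathcomp Require Import complex ring lra.

Set Implicit Arguments.
Unset Strict Implicit.
Unset Printing Implicit Defensive.

Import Order.TTheory GRing.Theory Num.Theory.
Local Open Scope ring_scope.
Local Open Scope complex_scope.
Local Open Scope sesquilinear_scope.

(** * Complex column vectors as a real Euclidean space *)

Section RealInnerProduct.
Variable R : rcfType.

Lemma ReD (x y : R[i]) : complex.Re (x + y) = complex.Re x + complex.Re y.
Proof. by case: x => a b; case: y. Qed.

(** Taking the real part leaves an inner product over the reals, which is enough for varying a real
    functional along real multiples of one direction. *)
Definition rdot n (a b : 'cV[R[i]]_n) : R := complex.Re ((a ^t* *m b) 0 0).

Lemma rdotDr n (a b c : 'cV[R[i]]_n) : rdot a (b + c) = rdot a b + rdot a c.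
Proof. by rewrite /rdot mulmxDr mxE ReD. Qed.

Lemma rdotZr n (a b : 'cV[R[i]]_n) (s : R) : rdot a (s%:C *: b) = s * rdot a b.
Proof.
by rewrite /rdot -scalemxAr mxE; case: (_ 0 0) => x y /=; rewrite mul0r subr0.
Qed.

Lemma adjmxD p n (B1 B2 : 'M[R[i]]_(p, n)) : (B1 + B2) ^t* = B1 ^t* + B2 ^t*.
Proof. by rewrite linearD map_mxD. Qed.

Lemma adjmxZ p n (c : R) (B : 'M[R[i]]_(p, n)) : (c%:C *: B) ^t* = c%:C *: B ^t*.
Proof.
by apply/matrixP => i j; rewrite !mxE rmorphM; congr (_ * _); apply: conjc_real.
Qed.

Lemma adjmxM p q n (B1 : 'M[R[i]]_(p, q)) (B2 : 'M_(q, n)) :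
  (B1 *m B2) ^t* = B2 ^t* *m B1 ^t*.
Proof. by rewrite trmx_mul map_mxM. Qed.

Lemma adj_scalar_mx n (c : R) : (c%:C%:M : 'M[R[i]]_n) ^t* = c%:C%:M.
Proof. by rewrite tr_scalar_mx map_scalar_mx; congr _%:M; apply: conjc_real. Qed.

Lemma rdotE n (a b : 'cV[R[i]]_n) :
  rdot a b = \sum_i (complex.Re (a i 0) * complex.Re (b i 0)
                     + complex.Im (a i 0) * complex.Im (b i 0)).
Proof.
rewrite /rdot mxE (big_morph _ ReD (erefl : complex.Re 0 = 0)).
apply: eq_bigr => i _; rewrite !mxE.
by case: (a i 0) => x y; case: (b i 0) => z t /=; ring.
Qed.

Lemma rdotC n (a b : 'cV[R[i]]_n) : rdot a b = rdot b a.
Proof. by rewrite !rdotE; apply: eq_bigr => i _; ring. Qed.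

Lemma rdotDl n (a b c : 'cV[R[i]]_n) : rdot (a + b) c = rdot a c + rdot b c.
Proof. by rewrite !(rdotC _ c) rdotDr. Qed.

Lemma rdotZl n (a b : 'cV[R[i]]_n) (s : R) : rdot (s%:C *: a) b = s * rdot a b.
Proof. by rewrite rdotC rdotZr rdotC. Qed.

Lemma rdot_adj p n (B : 'M[R[i]]_(p, n)) a b :
  rdot (B ^t* *m a) b = rdot a (B *m b).
Proof. by rewrite /rdot adjmxM trmxCK mulmxA. Qed.

Lemma rdot_sqnorm n (a : 'cV[R[i]]_n) : rdot a a = sqnorm a.
Proof.
rewrite rdotE; apply: eq_bigr => i _; case: (a i 0) => x y /=.
by rewrite sqr_sqrtr ?addr_ge0 ?sqr_ge0 // -!expr2.
Qed.

Lemma sqnormN n (a : 'cV[R[i]]_n) : sqnorm (- a) = sqnorm a.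
Proof.
have -> : - a = (-1)%:C *: a by rewrite rmorphN scaleN1r.
by rewrite -!rdot_sqnorm rdotZl rdotZr mulrA mulrNN !mul1r.
Qed.

Lemma rdot_ge0 n (a : 'cV[R[i]]_n) : 0 <= rdot a a.
Proof. by rewrite rdot_sqnorm sumr_ge0 // => i _; apply: sqr_ge0. Qed.

Lemma rdot_le0 n (a : 'cV[R[i]]_n) : rdot a a <= 0 -> a = 0.
Proof.
move=> a_le0; have /eqP := le_anti (introT andP (conj a_le0 (rdot_ge0 a))).
rewrite rdot_sqnorm psumr_eq0 => [/allP a0|i _]; last exact: sqr_ge0.
apply/colP => i; rewrite mxE; apply: Normc.eq0_normc; apply/eqP.
by rewrite -sqrf_eq0; apply: a0; rewrite mem_index_enum.
Qed.

End RealInnerProduct.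

(** * Positive semidefinite matrices, least-squares minimizers and a pencil without kernel *)

Section PositiveForms.
Variable R : rcfType.

(** Pairing a kernel vector v with its image gives c|Bv|^2 + t|v|^2 = 0, hence v = 0. *)
Lemma gram_shift_unit p n (B : 'M[R[i]]_(p, n)) (c t : R) :
  0 <= c -> 0 < t -> c%:C *: (B ^t* *m B) + t%:C%:M \in unitmx.
Proof.
move=> c_ge0 t_gt0; rewrite -unitmx_tr unitmxE unitfE; apply/det0P => -[v v0 vM].
have /(congr1 trmx): v *m (c%:C *: (B ^t* *m B) + t%:C%:M)^T = 0 by [].
rewrite trmx_mul trmxK trmx0 mulmxDl mul_scalar_mx -scalemxAl => Mv.
have /(congr1 (rdot (v^T))) := Mv.
rewrite rdotDr !rdotZr rdotC -mulmxA rdot_adj.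
have -> : rdot v^T 0 = 0 by rewrite /rdot mulmx0 mxE.
move=> vMv; move: v0; rewrite -[v]trmxK (rdot_le0 (a := v^T)) ?trmx0 ?eqxx //.
have := rdot_ge0 (B *m v^T); nra.
Qed.

(** First-order optimality without derivatives: stepping from x by -s times the gradient r changes J
    by exactly -s|r|^2 + s^2 K / 2, which would be negative for a small s > 0 if r were nonzero.
    [J0] collects the terms that do not depend on the minimized variable. *)
Lemma argmin_gradient p n (B : 'M[R[i]]_(p, n)) (g : 'cV[R[i]]_p)
    (h x : 'cV[R[i]]_n) (c t : R) (J : 'cV[R[i]]_n -> R) (J0 : R) :
    0 <= c -> 0 <= t ->
    (forall y, J y = J0 + c / 2 * sqnorm (B *m y - g) + t / 2 * sqnorm (y - h)) ->
  is_argmin J x -> c%:C *: (B ^t* *m (B *m x - g)) + t%:C *: (x - h) = 0.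
Proof.
move=> c_ge0 t_ge0 JE xmin; set r := (X in X = 0).
pose K := c * sqnorm (B *m r) + t * sqnorm r.
have K_ge0 : 0 <= K by rewrite addr_ge0 ?mulr_ge0 // -rdot_sqnorm rdot_ge0.
have rr : rdot r r = c * rdot (B *m x - g) (B *m r) + t * rdot (x - h) r.
  by rewrite {1}/r [LHS]rdotDl !rdotZl rdot_adj.
clearbody r.
have quad s : 0 <= - s * rdot r r + s ^+ 2 / 2 * K.
  have := xmin (x + (- s)%:C *: r); rewrite !JE.
  have -> : B *m (x + (- s)%:C *: r) - g = (B *m x - g) + (- s)%:C *: (B *m r).
    by rewrite mulmxDr -scalemxAr addrAC.
  rewrite [x + _ - h]addrAC; move: rr.
  move: (B *m x - g) (x - h) => y e rr.
  rewrite -!rdot_sqnorm !(rdotDl, rdotDr, rdotZl, rdotZr).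
  rewrite (rdotC (B *m r) y) (rdotC r e) /K -!rdot_sqnorm.
  rewrite rr; move: (rdot y y) (rdot e e) (rdot y _) (rdot e _).
  by move: (rdot (B *m r) _) (rdot r r); clear => *; lra.
apply: rdot_le0; rewrite leNgt; apply/negP => q_gt0.
have K1_gt0 : 0 < K + 1 by rewrite ltr_wpDl.
(* For s = |r|^2 / (K + 1) the change is -s^2 (K + 1) + s^2 K / 2 < 0; the added 1 keeps the
   denominator positive when K = 0. *)
have s_gt0 := divr_gt0 q_gt0 K1_gt0; have := quad (rdot r r / (K + 1)).
have sK := divfK (lt0r_neq0 K1_gt0) (rdot r r); move: sK s_gt0.
set s := _ / _ => <-; move: K_ge0; clear => *; nra.
Qed.

(* With x = (T2 + t) a, y = T2 a and z = (k + 1) x - y, the hypothesis reads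
   T1 z + t (k x + y) = 0, while <z, k x + y> = k (k + 1) |x|^2 + t <a, y>. *)
Lemma psd_pencil_inj n (T1 T2 : 'M[R[i]]_n) (t k : R) (a : 'cV[R[i]]_n) :
    (forall v, 0 <= rdot v (T1 *m v)) -> (forall v, 0 <= rdot v (T2 *m v)) ->
    0 < t -> 0 < k ->
    t%:C *: ((T1 + T2) *m a) + k%:C *: ((T1 + t%:C%:M) *m ((T2 + t%:C%:M) *m a)) = 0 ->
  a = 0.
Proof.
move=> T1_ge0 T2_ge0 t_gt0 k_gt0.
have xE : (T2 + t%:C%:M) *m a = T2 *m a + t%:C *: a by rewrite mulmxDl mul_scalar_mx.
rewrite mulmxDl [(T1 + t%:C%:M) *m _]mulmxDl mul_scalar_mx xE.
have := T2_ge0 a; move: (T2 *m a) => y ay_ge0 eq0.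
pose x := y + t%:C *: a.
have {eq0} zE : T1 *m ((k + 1)%:C *: x - y) + t%:C *: (k%:C *: x + y) = 0.
  have -> : (k + 1)%:C = k%:C + 1 by rewrite rmorphD rmorph1.
  rewrite -[RHS]eq0 /x mulmxBr -!scalemxAr mulmxDr -scalemxAr.
  move: (T1 *m y) (T1 *m a) k%:C t%:C => u v k' t'.
  apply/colP => i; rewrite !mxE.
  by move: (y i 0) (a i 0) (u i 0) (v i 0); clear => *; ring.
have := T1_ge0 ((k + 1)%:C *: x - y).
have /eqP := zE; rewrite addr_eq0 => /eqP ->.
have -> : - (t%:C *: (k%:C *: x + y)) = (- t)%:C *: (k%:C *: x + y).
  by rewrite rmorphN scaleNr.
have -> : - y = (-1)%:C *: y by rewrite rmorphN scaleN1r.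
have xy : rdot x y = rdot y y + t * rdot a y by rewrite /x [LHS]rdotDl rdotZl.
have ax : rdot a x = rdot a y + t * rdot a a by rewrite /x [LHS]rdotDr rdotZr.
move: x xy ax {zE} => x xy ax.
rewrite !(rdotDl, rdotDr, rdotZl, rdotZr) (rdotC y x) => z_ge0.
have : x = 0.
  apply: rdot_le0; move: z_ge0 ay_ge0; rewrite xy.
  move: (rdot x x) (rdot y y) (rdot a y) => X Y a_y z_ge0 ay_ge0.
  rewrite leNgt; apply/negP => X_gt0.
  have := mulr_gt0 (mulr_gt0 t_gt0 k_gt0) (mulr_gt0 (addr_gt0 k_gt0 ltr01) X_gt0).
  have := mulr_ge0 (mulr_ge0 (ltW t_gt0) (ltW t_gt0)) ay_ge0.
  by move: z_ge0; clear; lra.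
(* With x = 0, the identity <a, x> = <a, y> + t|a|^2 is a vanishing sum of nonnegative terms. *)
move=> x0; apply: rdot_le0; move: ax ay_ge0; rewrite x0 {1}/rdot mulmx0 mxE /=.
rewrite -(pmulr_rle0 (rdot a a) t_gt0).
by move: (t * rdot a a) (rdot a y); clear => *; lra.
Qed.

(** [eigenvalue] speaks of row vectors, so the column version is transported by conjugate
    transposition, which reverses the products and fixes the Hermitian factors. *)
Lemma psd_pencil_row_inj n (T1 T2 : 'M[R[i]]_n) (t k : R) (y : 'rV[R[i]]_n) :
    T1 ^t* = T1 -> T2 ^t* = T2 ->
    (forall v, 0 <= rdot v (T1 *m v)) -> (forall v, 0 <= rdot v (T2 *m v)) ->
    0 < t -> 0 < k ->
    t%:C *: (y *m (T1 + T2)) + k%:C *: (y *m (T2 + t%:C%:M) *m (T1 + t%:C%:M)) = 0 ->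
  y = 0.
Proof.
move=> T1_adj T2_adj T1_ge0 T2_ge0 t_gt0 k_gt0 /(congr1 (fun z => z ^t*)) eq0.
suff y0 : y ^t* = 0 by rewrite -[y]trmxCK y0 trmx0 map_mx0.
apply: (psd_pencil_inj T1_ge0 T2_ge0 t_gt0 k_gt0); move: eq0.
by rewrite trmx0 map_mx0 adjmxD !adjmxZ !adjmxM !adjmxD T1_adj T2_adj adj_scalar_mx.
Qed.

End PositiveForms.

(* mathcomp's spectral library has another realmx. *)
Local Notation realmx := Defs.realmx.

(** * Elimination of w and b from the ADMM run, and the sign of the real eigenvalues of Q *)

Section Iteration.
Variables (R : rcfType) (m n : nat).
Variables (mu theta : R) (A : 'M[R[i]]_(m, n)) (L : 'M[R]_n).
Hypotheses (mu_gt0 : 0 < mu) (theta_gt0 : 0 < theta).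

Lemma realmx_tr p q (M : 'M[R]_(p, q)) : (realmx M)^T = (realmx M) ^t*.
Proof. by apply/matrixP => i j; rewrite !mxE; apply/esym/conjc_real. Qed.

Local Notation P := (mu%:C *: (A ^t* *m A)).
Local Notation S := ((realmx L)^T *m realmx L).
Local Notation tI := (theta%:C%:M : 'M[R[i]]_n).

Lemma shiftP_unit : P + tI \in unitmx.
Proof. by rewrite gram_shift_unit // ltW. Qed.

Lemma shiftS_unit : S + tI \in unitmx.
Proof.
by have := gram_shift_unit (realmx L) ler01 theta_gt0; rewrite rmorph1 scale1r -realmx_tr.
Qed.

Lemma admm_is_iteration_matrix f alpha :
  is_iteration_matrix mu A L f theta alpha (1%:M + alpha%:C *: Qmx mu A L theta).
Proof.
pose c0 := mu%:C *: (A ^t* *m f).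
exists ((alpha * theta)%:C *: (invmx (P + tI) *m (invmx (S + tI) *m c0))).
move=> u w b run.
have w_step k : (S + tI) *m w k.+1 = theta%:C *: (u k + b k).
  case: (run k) => wmin _ _.
  have := argmin_gradient (B := realmx L) (g := 0) (h := u k + b k)
    (J0 := mu / 2 * sqnorm (A *m u k - f)) ler01 (ltW theta_gt0) _ wmin.
  rewrite rmorph1 scale1r subr0 mulmxA -realmx_tr => grad0; apply/eqP.
  rewrite -subr_eq0 mulmxDl mul_scalar_mx -addrA -scalerBr grad0 // => y.
  by rewrite /aug_lagrangian subr0 opprD addrA.
have u_step k : (P + tI) *m u k.+1 =
    c0 + theta%:C *: (over_relax alpha (w k.+1) (u k) - b k).
  case: (run k); set wr := over_relax _ _ _ => _ umin _.
  have := argmin_gradient (B := A) (g := f) (h := wr - b k)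
    (J0 := 1 / 2 * sqnorm (realmx L *m wr)) (ltW mu_gt0) (ltW theta_gt0) _ umin.
  rewrite mulmxBr mulmxA !scalerBr mulmxDl mul_scalar_mx -scalemxAl => grad0.
  apply/eqP; rewrite -subr_eq0 -[X in _ == X]grad0; last first.
    move=> y; rewrite /aug_lagrangian; congr (_ + _ / 2 * _); first by rewrite addrC.
    by rewrite -sqnormN; congr (sqnorm _); rewrite !opprB addrC addrA addrAC.
  by apply/eqP; rewrite /c0 opprD addrACA.
(* Comparing the stationarity equation in u with the multiplier update cancels the relaxed vector:
   after a completed step, b is a function of u alone. *)
have b_step k : theta%:C *: b k.+1 = c0 - P *m u k.+1.
  case: (run k) => _ _ ->; have := u_step k.
  rewrite mulmxDl mul_scalar_mx; move: (over_relax _ _ _) => wr /eqP.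
  rewrite -subr_eq => /eqP <-; apply/colP => i; rewrite !mxE; ring.
move=> k.
(* Inserting [b_step] into [u_step] cancels c0 and leaves an increment of u proportional to
   alpha. *)
have Uu : (P + tI) *m u k.+2 =
    (P + tI) *m u k.+1 + (alpha * theta)%:C *: (w k.+2 - u k.+1).
  rewrite u_step scalerBr b_step /over_relax mulmxDl mul_scalar_mx.
  rewrite rmorphM rmorphB rmorph1; apply/colP => i; rewrite !mxE; ring.
have -> : u k.+2 = u k.+1 + (alpha * theta)%:C *: (invmx (P + tI) *m (w k.+2 - u k.+1)).
  rewrite -[LHS](mulKmx shiftP_unit) Uu mulmxDr (mulKmx shiftP_unit).
  by rewrite -scalemxAr.
(* By [b_step], t (u + b) = (t - P) u + c0, so w is affine in u as well. *)
have -> : w k.+2 = invmx (S + tI) *m ((tI - P) *m u k.+1 + c0).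
  rewrite -[LHS](mulKmx shiftS_unit) w_step scalerDr b_step mulmxBl mul_scalar_mx.
  by congr (_ *m _); apply/colP => i; rewrite !mxE; ring.
rewrite /Qmx mulmxDl mul1mx -addrA; congr (_ + _).
rewrite scalerA -rmorphM -scalemxAl -scalerDr; congr (_ *: _).
rewrite -[X in _ = X + _]mulmxA -mulmxDr; congr (_ *m _).
by rewrite mulmxDr [X in _ = X + _]mulmxBl mul1mx mulmxA addrAC.
Qed.

(** Writing the identity as (S + t)^-1 (S + t) turns the bracket of Q into (S + t)^-1 ((t - P) - (S
    + t)), where t cancels. *)
Lemma Qmx_factored :
  Qmx mu A L theta = - theta%:C *: (invmx (P + tI) *m invmx (S + tI) *m (P + S)).
Proof.
rewrite /Qmx /= scaleNr -scalerN -mulmxA -mulmxN; congr (_ *: (_ *m _)).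
rewrite -[1%:M](mulVmx shiftS_unit) -mulmxBr -mulmxN; congr (_ *m _).
by rewrite (addrC S) opprD addrACA subrr add0r -opprD.
Qed.

(** For a left eigenvector v, the row y = v (P + t)^-1 (S + t)^-1 satisfies t y (P + S) + k y (S +
    t)(P + t) = 0, which is impossible for k > 0 and y nonzero. *)
Lemma Qmx_real_eigenvalue_le0 (k : R) :
  eigenvalue (Qmx mu A L theta) k%:C -> k <= 0.
Proof.
move=> /eigenvalueP[v vQ v0]; rewrite leNgt; apply: contra v0 => k_gt0.
pose y := v *m invmx (P + tI) *m invmx (S + tI).
have vE : v = y *m (S + tI) *m (P + tI).
  by rewrite (mulmxKV shiftS_unit) (mulmxKV shiftP_unit).
have P_adj : P ^t* = P.
  by rewrite adjmxZ adjmxM trmxCK.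
have S_adj : S ^t* = S by rewrite realmx_tr adjmxM trmxCK.
have P_ge0 c : 0 <= rdot c (P *m c).
  by rewrite -scalemxAl rdotZr -mulmxA rdotC rdot_adj mulr_ge0 ?rdot_ge0 // ltW.
have S_ge0 c : 0 <= rdot c (S *m c).
  by rewrite realmx_tr -mulmxA rdotC rdot_adj rdot_ge0.
rewrite vE (psd_pencil_row_inj (y := y) P_adj S_adj P_ge0 S_ge0 theta_gt0 k_gt0).
  by rewrite !mul0mx.
by rewrite -vE -vQ Qmx_factored -scalemxAr scaleNr !mulmxA subrr.
Qed.

End Iteration.

(** * Spectral radius of 1 + alpha T and the extreme eigenvalues of a real spectrum *)

Section SpectralRadius.
Variables (R : rcfType) (n : nat).
Implicit Types (T : 'M[R[i]]_n) (z : R[i]).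

Lemma size_spectrum T : size (spectrum T) = n.
Proof.
by apply: succn_inj; rewrite -(size_char_poly T) char_poly_spectrum size_prod_XsubC.
Qed.

Lemma spectral_radius_ge T z : eigenvalue T z -> Normc.normc z <= spectral_radius T.
Proof.
rewrite -mem_spectrum /spectral_radius; elim: spectrum => //= y s IHs.
rewrite inE big_cons le_max => /orP[/eqP-> | /IHs ->]; last by rewrite orbT.
by rewrite lexx.
Qed.

(** The bound on c from below accounts for the initial value 0 of the maximum. *)
Lemma spectral_radius_le T (c : R) : 0 <= c ->
  (forall z, eigenvalue T z -> Normc.normc z <= c) -> spectral_radius T <= c.
Proof.
move=> c_ge0 le_c; rewrite /spectral_radius big_seq.
elim/big_ind: _ => // [x y xc yc|z]; first by rewrite ge_max xc.
by rewrite mem_spectrum => /le_c.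
Qed.

Lemma normc_affine (a x : R) : Normc.normc (1 + a%:C * x%:C) = `|1 + a * x|.
Proof.
have -> : 1 + a%:C * x%:C = (1 + a * x)%:C by rewrite rmorphD rmorphM rmorph1.
by rewrite /= expr0n addr0 sqrtr_sqr.
Qed.

Lemma eigenvalue_shift T (a z : R[i]) :
  eigenvalue T z -> eigenvalue (1%:M + a *: T) (1 + a * z).
Proof.
move=> /eigenvalueP[v vT v0]; apply/eigenvalueP; exists v => //.
by rewrite mulmxDr mulmx1 -scalemxAr vT scalerA scalerDl scale1r.
Qed.

Lemma eigenvalue_shiftP T (a w : R[i]) : (0 < n)%N ->
  eigenvalue (1%:M + a *: T) w -> exists2 z, eigenvalue T z & w = 1 + a * z.
Proof.
move=> n_gt0 /eigenvalueP[v + v0]; rewrite mulmxDr mulmx1 -scalemxAr => vE.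
have {}vE : a *: (v *m T) = (w - 1) *: v by rewrite scalerBl scale1r -vE addrC addKr.
have [a0|a0] := eqVneq a 0; last first.
  exists ((w - 1) / a); last by rewrite mulrC divfK // addrC subrK.
  apply/eigenvalueP; exists v => //.
  by rewrite mulrC -scalerA -vE scalerA mulVf // scale1r.
(* When a = 0 the only eigenvalue is w = 1, and any eigenvalue z of T serves as witness; one exists
   because n > 0. *)
have := size_spectrum T; case Es: (spectrum T) => [|z s]; first by move=> n0; exfalso; move: n_gt0; rewrite -n0.
exists z; first by rewrite -mem_spectrum Es mem_head.
move/eqP: vE; rewrite a0 scale0r eq_sym scaler_eq0 (negPf v0) orbF subr_eq0 mul0r addr0.
by move/eqP.
Qed.

Lemma mem_real_eigenvalues T (x : R) :
  real_spectrum T -> (x \in [seq complex.Re z | z <- spectrum T]) = eigenvalue T x%:C.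
Proof.
move=> realT; rewrite -mem_spectrum; apply/mapP/idP => [[z Tz ->]|Tx].
  by rewrite RRe_real // realT.
by exists x%:C.
Qed.

Lemma lambda_eigenvalue T (k : nat) : real_spectrum T -> (0 < k <= n)%N ->
  eigenvalue T (lambda k T)%:C.
Proof.
move=> realT /andP[k_gt0 k_le]; rewrite -mem_real_eigenvalues // -(mem_sort <=%R).
by rewrite mem_nth // size_sort size_map size_spectrum prednK.
Qed.

Lemma lambda_bounds T (x : R) : real_spectrum T -> (0 < n)%N ->
  eigenvalue T x%:C -> lambda 1 T <= x <= lambda n T.
Proof.
move=> realT n_gt0; rewrite -mem_real_eigenvalues // -(mem_sort <=%R) /lambda.
have := sort_sorted (@le_total _ R) [seq complex.Re z | z <- spectrum T].
have := size_sort <=%R [seq complex.Re z | z <- spectrum T].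
rewrite size_map size_spectrum; move: (sort _ _) => s sz_s sort_s.
move=> /(nthP 0)[j]; rewrite sz_s => j_lt <-.
by rewrite !(sorted_leq_nth le_trans le_refl) // ?inE ?sz_s ?prednK // -ltnS prednK.
Qed.

Lemma eigenvalue_unit T : T \in unitmx -> ~~ eigenvalue T 0.
Proof.
move=> uT; apply/negP => /eigenvalueP[v vT]; case/negP.
by rewrite -[v](mulmxK uT) vT scale0r mul0mx.
Qed.

Lemma relax_radius_ge T (beta x : R) : eigenvalue T x%:C ->
  `|1 + beta * x| <= spectral_radius (1%:M + beta%:C *: T).
Proof.
move=> /(eigenvalue_shift beta%:C)/spectral_radius_ge.
by rewrite normc_affine.
Qed.

Lemma relax_radius_le T (beta c : R) : real_spectrum T -> (0 < n)%N -> 0 <= c ->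
  (forall x, eigenvalue T x%:C -> `|1 + beta * x| <= c) ->
  spectral_radius (1%:M + beta%:C *: T) <= c.
Proof.
move=> realT n_gt0 c_ge0 le_c; apply: spectral_radius_le => // w.
move=> /eigenvalue_shiftP => /(_ n_gt0)[z Tz ->].
have /complex_realP[x xE] : z \is Num.real by rewrite realT // mem_spectrum.
move: Tz; rewrite xE => Tx.
by rewrite normc_affine; apply: le_c.
Qed.

End SpectralRadius.

(** * The minimax problem for |1 + beta x| on an interval [a, b] *)

Section ScalarMinimax.
Variable R : realFieldType.
Implicit Types a b beta r x : R.

(* b (1 + beta a) - a (1 + beta b) = b - a, whatever beta. *)
Lemma minimax_affine_ge a b beta r : a <= 0 -> b <= 0 ->
  `|1 + beta * a| <= r -> `|1 + beta * b| <= r -> b - a <= - (a + b) * r.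
Proof. by rewrite !ler_norml => ? ? /andP[? ?] /andP[? ?]; nra. Qed.

(** Multiplied by -(a + b), the affine function becomes 2x - (a + b), which runs from -(b - a) to b
    - a on [a, b]. *)
Lemma minimax_affine_le a b x : a + b < 0 -> a <= x <= b ->
  `|1 - 2 / (a + b) * x| <= (b - a) / - (a + b).
Proof.
move=> ab_lt0 /andP[ax xb]; have s_gt0 : 0 < - (a + b) by rewrite oppr_gt0.
rewrite ler_pdivlMr // -[X in _ * X](gtr0_norm s_gt0) -normrM.
have -> : (1 - 2 / (a + b) * x) * - (a + b) = 2 * x - (a + b).
  by field; apply: ltr0_neq0.
by rewrite ler_norml; apply/andP; split; lra.
Qed.

(** Equality in [minimax_affine_ge] with a and b strictly negative forces 1 + beta a = -r and 1 +
    beta b = r; their sum determines beta. *)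
Lemma minimax_affine_unique a b beta r : a < 0 -> b < 0 ->
  `|1 + beta * a| <= r -> `|1 + beta * b| <= r -> - (a + b) * r <= b - a ->
  beta = - (2 / (a + b)).
Proof.
rewrite !ler_norml => a_lt0 b_lt0 /andP[a1 a2] /andP[b1 b2] le_gap.
have ra : 1 + beta * a = - r by apply/le_anti/andP; split=> //; nra.
have rb : 1 + beta * b = r by apply/le_anti/andP; split=> //; nra.
have ab0 : a + b != 0 by lra.
by apply: (mulIf ab0); rewrite mulNr divfK //; lra.
Qed.

End ScalarMinimax.

(** Uniqueness is stated for invertible Q: if 0 is an eigenvalue, no factor is below 1, and with a
    the smallest eigenvalue, every alpha >= 0 with alpha a >= -2 attains 1. *)
Theorem theorem2 (R : rcfType) (m n : nat) (mu theta : R)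
    (A : 'M[R[i]]_(m, n)) (L : 'M[R]_n)
    (hmn : (m <= n)%N) (hn : (0 < n)%N) (hmu : 0 < mu) (htheta : 0 < theta) :
  let Q := Qmx mu A L theta in
  let alpha_star := - (2 / (lambda 1 Q + lambda n Q)) in
  (forall (f : 'cV[R[i]]_m) (alpha : R),
     is_iteration_matrix mu A L f theta alpha (1%:M + alpha%:C *: Q))
  /\ (real_spectrum Q ->
      is_optimal_relaxation mu A L theta alpha_star
      /\ (Q \in unitmx ->
            forall alpha : R,
              is_optimal_relaxation mu A L theta alpha -> alpha = alpha_star)).
Proof.
move=> Q alpha_star; split=> [f alpha|realQ]; first exact: admm_is_iteration_matrix.
pose a := lambda 1 Q; pose b := lambda n Q.
have Qa : eigenvalue Q a%:C by apply: lambda_eigenvalue.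
have Qb : eigenvalue Q b%:C by apply: lambda_eigenvalue; rewrite ?hn ?leqnn.
have a_le0 : a <= 0 by apply: (Qmx_real_eigenvalue_le0 hmu htheta Qa).
have b_le0 : b <= 0 by apply: (Qmx_real_eigenvalue_le0 hmu htheta Qb).
have ab : a <= b by have /andP[] := lambda_bounds realQ hn Qb.
have star_le : a < 0 -> conv_factor mu A L theta alpha_star <= (b - a) / - (a + b).
  move=> a_lt0; have ab_lt0 : a + b < 0 by rewrite ltr_nwDl.
  apply: relax_radius_le => // [|x Qx].
    by rewrite divr_ge0 ?subr_ge0 // oppr_ge0 ltW.
  by rewrite mulNr minimax_affine_le // lambda_bounds.
split=> [beta|unitQ alpha opt].
  have ge_a := relax_radius_ge beta Qa; have ge_b := relax_radius_ge beta Qb.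
  have [a_lt0|a_ge0] := ltP a 0.
    apply: le_trans (star_le a_lt0) _; have ab_lt0 : a + b < 0 by rewrite ltr_nwDl.
    rewrite ler_pdivrMr ?oppr_gt0 // mulrC; exact: minimax_affine_ge ge_a ge_b.
  (* Here all eigenvalues of Q vanish, so every alpha gives the same factor; [alpha_star] is 0 by
     the convention for division by zero. *)
  have a0 : a = 0 by apply/le_anti/andP.
  apply: relax_radius_le => // [|x Qx]; first exact: le_trans (normr_ge0 _) ge_a.
  have /andP[ax xb] := lambda_bounds realQ hn Qx.
  have -> : x = a by apply/le_anti; rewrite ax andbT a0 (le_trans xb).
  by move: ge_a; rewrite a0 !mulr0.
have b_lt0 : b < 0.
  rewrite lt_neqAle b_le0 andbT; apply: contra (eigenvalue_unit unitQ) => /eqP b0.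
  by move: Qb; rewrite b0 rmorph0.
have a_lt0 := le_lt_trans ab b_lt0.
apply: (minimax_affine_unique a_lt0 b_lt0 (relax_radius_ge alpha Qa) (relax_radius_ge alpha Qb)).
(* Optimality of alpha against [alpha_star] supplies the reverse inequality, that is, the equality
   case of the minimax bound. *)
have := le_trans (opt alpha_star) (star_le a_lt0).
by rewrite ler_pdivlMr ?oppr_gt0 ?ltr_nwDl // mulrC.
Qed.
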